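(* Let $I=(N,M,c_1,\ldots,c_n)$ be an additive chores instance with $n\ge 2$ agents and $m$ items. Construct an additive goods instance $I'=(N,M',v_1,\ldots,v_n)$ with the same $n$ agents and $nm$ items as follows. Let $K=1+\max_{i\in N}c_i(M)$. For each item $g\in M$, put one item $g'$ into $M'$ with $v_i(g')=K-c_i(g)$ for each $i\in N$. In addition, put $(n-1)m$ further goods into $M'$, each of which has value $K$ for every agent. Then $I$ admits a PMMS allocation (for chores) if and only if $I'$ admits a PMMS allocation (for goods).
   Context: $N=[n]=\{1,\dots,n\}$ is a finite set of agents and $M$ a finite set of indivisible items. An allocation $X=(X_i)_{i\in N}$ is a partition of the item set into $n$ (possibly empty) bundles indexed by agents. $\Pi_2(S)$ is the set of ordered bipartitions $(P_1,P_2)$ of a bundle $S$ (parts may be empty). Additive goods instance: each agent $i$ has an additive valuation $v_i:2^{M}\to\mathbb{R}_{\ge0}$ (the value of a bundle is the sum of the values of its items). An allocation $X$ is PMMS (pairwise maximin share) for goods if for all $i\neq j$, $v_i(X_i)\ge \max_{(P_1,P_2)\in\Pi_2(X_i\cup X_j)}\min\{v_i(P_1),v_i(P_2)\}$. Additive chores instance: each agent $i$ has an additive cost function $c_i:2^{M}\to\mathbb{R}_{\ge0}$. An allocation $X$ is PMMS for chores if for all $i\ne j$, $c_i(X_i)\le \min_{(P_1,P_2)\in\Pi_2(X_i\cup X_j)}\max\{c_i(P_1),c_i(P_2)\}$. *)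

(* Defs.v *)
From HB Require Import structures.
From mathcomp Require Import all_boot all_order all_algebra.
Set Implicit Arguments.
Unset Strict Implicit.
Unset Printing Implicit Defensive.
Import Order.TTheory GRing.Theory Num.Theory.
Local Open Scope ring_scope.

(* Additive functions on bundles are given by their values on single items.
   The same data serve as a goods instance (valuations) and as a chores
   instance (costs). *)
Record instance (R : realFieldType) (n : nat) (M : finType) := Instance {
  item_value : 'I_n -> M -> R;
  item_value_ge0 : forall i g, 0 <= item_value i g }.

Definition bundle_value (R : realFieldType) (n : nat) (M : finType)
    (I : instance R n M) (i : 'I_n) (S : {set M}) : R :=
  \sum_(g in S) item_value I i g.

(* [partition] of finset cannot be used here: it forbids empty blocks and does
   not index them by agents. *)
Definition allocation (n : nat) (M : finType) (X : 'I_n -> {set M}) : Prop :=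
  \bigcup_(i < n) X i = [set: M] /\
  forall i j : 'I_n, i != j -> [disjoint X i & X j].

Definition bipartitions (M : finType) (S : {set M}) : {set {set M} * {set M}} :=
  [set P | (P.1 :|: P.2 == S) && [disjoint P.1 & P.2]].

(* The index element of the iterated max (resp. min) below is the value at the
   bipartition (S, set0), so these are the exact maximum and minimum over
   [bipartitions S]. *)
Definition max_min_share (R : realFieldType) (M : finType) (v : {set M} -> R)
    (S : {set M}) : R :=
  \big[Num.max/Num.min (v S) (v set0)]_(P in bipartitions S)
    Num.min (v P.1) (v P.2).

Definition min_max_share (R : realFieldType) (M : finType) (c : {set M} -> R)
    (S : {set M}) : R :=
  \big[Num.min/Num.max (c S) (c set0)]_(P in bipartitions S)
    Num.max (c P.1) (c P.2).

Definition PMMS_goods (R : realFieldType) (n : nat) (M : finType)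
    (I : instance R n M) (X : 'I_n -> {set M}) : Prop :=
  forall i j : 'I_n, i != j ->
    max_min_share (bundle_value I i) (X i :|: X j) <= bundle_value I i (X i).

Definition PMMS_chores (R : realFieldType) (n : nat) (M : finType)
    (I : instance R n M) (X : 'I_n -> {set M}) : Prop :=
  forall i j : 'I_n, i != j ->
    bundle_value I i (X i) <= min_max_share (bundle_value I i) (X i :|: X j).

(* Costs are nonnegative, so the index element 0 does not affect the maximum
   over a nonempty set of agents. *)
Definition bigK (R : realFieldType) (n : nat) (M : finType)
    (I : instance R n M) : R :=
  1 + \big[Num.max/0]_(i < n) bundle_value I i [set: M].

(* [inl g] is the good g' attached to the chore g; the [inr] summand consists
   of the (n - 1) m further goods. *)
Definition goods_items (n : nat) (M : finType) : finType :=
  (M + 'I_((n - 1) * #|M|))%type.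

Definition goods_value (R : realFieldType) (n : nat) (M : finType)
    (I : instance R n M) (i : 'I_n) (x : goods_items n M) : R :=
  match x with
  | inl g => bigK I - item_value I i g
  | inr _ => bigK I
  end.

Lemma goods_value_ge0 (R : realFieldType) (n : nat) (M : finType)
    (I : instance R n M) (i : 'I_n) (x : goods_items n M) :
  0 <= goods_value I i x.
Proof.
have hK (g : M) : item_value I i g <= bigK I.
  have h1 : item_value I i g <= bundle_value I i [set: M].
    rewrite /bundle_value (bigD1 g) ?inE //= lerDl.
    by apply: sumr_ge0 => h _; apply: item_value_ge0.
  apply: (le_trans h1); apply: (@le_trans _ _ (bigK I - 1)).
    by rewrite /bigK addrAC subrr add0r; exact: (le_bigmax _ (fun j => bundle_value I j [set: M])).
  by rewrite gerBl ler01.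
case: x => [g|_] /=; first by rewrite subr_ge0.
rewrite /bigK addr_ge0 ?ler01 //; exact: bigmax_ge_id.
Qed.

Definition goods_of_chores (R : realFieldType) (n : nat) (M : finType)
    (I : instance R n M) : instance R n (goods_items n M) :=
  Instance (goods_value_ge0 I).

Lemma card_goods_items (n : nat) (M : finType) :
  (0 < n)%N -> #|goods_items n M| = (n * #|M|)%N.
Proof.
by case: n => // n _; rewrite /goods_items card_sum card_ord subn1 mulSn.
Qed.

(* Main.v *)
(** Every good is worth K up to the cost of the chore behind it, and each
    agent's total cost is below K, so an agent always prefers the bundle with
    more goods, and between bundles of equal size the one whose chores cost
    less.  Hence in a PMMS allocation of the goods all bundles have the same
    size, namely the number m of chores, and in an allocation into bundles of
    size m only the bipartitions into two parts of size m matter; after removal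
    of the further goods these are exactly the bipartitions of the chores. *)
Require Import Defs.
From mathcomp Require Import all_boot all_order all_algebra.
From mathcomp Require Import zify lra.
Set Implicit Arguments.
Unset Strict Implicit.
Unset Printing Implicit Defensive.
Import Order.TTheory GRing.Theory Num.Theory.
Local Open Scope ring_scope.

(** * Counting in finite types *)

Lemma exists_subset_card (T : finType) (S : {set T}) (k : nat) :
  (k <= #|S|)%N -> exists2 A : {set T}, A \subset S & #|A| = k.
Proof.
move=> kS; exists [set x in take k (enum S)].
  by apply/subsetP=> x; rewrite inE => /mem_take; rewrite mem_enum.
rewrite cardsE; have /card_uniqP -> : uniq (take k (enum S)).
  by rewrite take_uniq ?enum_uniq.
by rewrite size_take_min -cardE; apply/minn_idPl.
Qed.

(** Equal cardinality gives a bijection from [T] to the disjoint union of the ['I_(k i)]; [f] reads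
    off the tag. This serves to deal the further goods to the agents in prescribed numbers. *)
Lemma exists_fun_card_fibers (I T : finType) (k : I -> nat) :
  (\sum_i k i)%N = #|T| ->
  exists f : T -> I, forall i, #|[set t | f t == i]| = k i.
Proof.
move=> sumk; pose U : finType := {i : I & 'I_(k i)}.
have cardU : #|T| = #|U|.
  by rewrite card_tagged sumnE big_map big_enum -sumk; apply: eq_bigr => i _; rewrite card_ord.
pose h (t : T) : U := enum_val (cast_ord cardU (enum_rank t)).
have h_bij : bijective h.
  exists (fun u => enum_val (cast_ord (esym cardU) (enum_rank u))) => x.
    by rewrite /h enum_valK cast_ordK enum_rankK.
  by rewrite /h enum_valK cast_ordKV enum_rankK.
exists (fun t => tag (h t)) => i.
have -> : [set t | tag (h t) == i] = h @^-1: [set u | tag u == i].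
  by apply/setP=> t; rewrite !inE.
rewrite on_card_preimset; last exact: onW_bij.
pose inj_i (x : 'I_(k i)) : U := Tagged (fun j => 'I_(k j)) x.
have -> : [set u : U | tag u == i] = [set inj_i x | x in 'I_(k i)].
  apply/setP=> u; rewrite inE; apply/eqP/imsetP => [|[x _ ->]//].
  by case: u => j x /= eji; subst j; exists x.
rewrite card_imset ?card_ord // => x y /eqP.
by rewrite eq_Tagged => /eqP.
Qed.

(** If some [k i] were below [m], no other value could exceed [m] and the sum would fall short; if
    it were above, no other value could be below [m] and the sum would be too large. *)
Lemma constant_of_balanced (n m : nat) (k : 'I_n -> nat) :
  (forall i j, (k j <= (k i).+1)%N) -> (\sum_i k i)%N = (n * m)%N ->
  forall i, k i = m.
Proof.
move=> bal sumk i.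
have nm : (n * m)%N = (\sum_(j < n) m)%N by rewrite sum_nat_const card_ord.
rewrite nm (bigD1 i) //= [RHS](bigD1 i) //= in sumk.
set s := (\sum_(j < n | j != i) k j)%N in sumk.
set t := (\sum_(j < n | j != i) m)%N in sumk.
have [lt_m|gt_m|//] := ltngtP (k i) m.
- have : (s <= t)%N.
    by apply: leq_sum => j _; apply: leq_trans (bal i j) _.
  lia.
- have : (t <= s)%N.
    by apply: leq_sum => j _; have := bal j i; lia.
  lia.
Qed.

Lemma sum_card_allocation (n : nat) (T : finType) (X : 'I_n -> {set T}) :
  allocation X -> (\sum_i #|X i|)%N = #|T|.
Proof.
case=> cov dis; rewrite -cardsT -cov -sum1_card partition_disjoint_bigcup //.
by apply: eq_bigr => i _; rewrite sum1_card.
Qed.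

Lemma card_sum_preim (A B : finType) (S : {set A + B}) :
  #|S| = (#|inl @^-1: S| + #|inr @^-1: S|)%N.
Proof.
by rewrite -sum1_card big_sumType /= -!sum1_card; congr (_ + _)%N;
  apply: eq_bigl => x; rewrite inE.
Qed.

(** * Shares as quantified bounds, and the size of K *)

Section Shares.
Variables (R : realFieldType) (n : nat) (M : finType) (I : instance R n M).

Lemma max_min_share_leP (v : {set M} -> R) (S : {set M}) (a : R) :
  max_min_share v S <= a <->
  forall P Q, P :|: Q = S -> [disjoint P & Q] -> Num.min (v P) (v Q) <= a.
Proof.
split=> [/bigmax_leP[_ le_a] P Q PQ dPQ | le_a].
  by apply: (le_a (P, Q)); rewrite inE PQ eqxx.
apply/bigmax_leP; split; first by apply: le_a; rewrite -?setI_eq0 (setU0, setI0).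
by move=> [P Q]; rewrite inE /= => /andP[/eqP PQ dPQ]; apply: le_a.
Qed.

Lemma le_min_max_shareP (c : {set M} -> R) (S : {set M}) (a : R) :
  a <= min_max_share c S <->
  forall P Q, P :|: Q = S -> [disjoint P & Q] -> a <= Num.max (c P) (c Q).
Proof.
split=> [/bigmin_geP[_ ge_a] P Q PQ dPQ | ge_a].
  by apply: (ge_a (P, Q)); rewrite inE PQ eqxx.
apply/bigmin_geP; split; first by apply: ge_a; rewrite -?setI_eq0 (setU0, setI0).
by move=> [P Q]; rewrite inE /= => /andP[/eqP PQ dPQ]; apply: ge_a.
Qed.

Lemma bundle_value_ge0 (i : 'I_n) (S : {set M}) : 0 <= bundle_value I i S.
Proof. by apply: sumr_ge0 => g _; apply: item_value_ge0. Qed.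

Lemma bundle_value_lt_bigK (i : 'I_n) (S : {set M}) :
  bundle_value I i S < bigK I.
Proof.
have le_all : bundle_value I i S <= bundle_value I i [set: M].
  rewrite /bundle_value [leRHS](big_setID S) /= setTI.
  by rewrite lerDl; apply: sumr_ge0 => g _; apply: item_value_ge0.
apply: le_lt_trans le_all _; rewrite /bigK.
have := le_bigmax 0 (fun j => bundle_value I j [set: M]) i; lra.
Qed.

End Shares.

(** * Comparing goods bundles with the chores inside them *)

Section Reduction.
Variables (R : realFieldType) (n : nat) (M : finType) (I : instance R n M).
Implicit Types (S P Q : {set goods_items n M}) (i j : 'I_n).

Lemma bundle_value_goods i S :
  bundle_value (goods_of_chores I) i S =
  bigK I *+ #|S| - bundle_value I i (inl @^-1: S).
Proof.
rewrite card_sum_preim mulrnDr addrAC /bundle_value big_sumType /=.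
congr (_ + _); last first.
  by rewrite sumr_const; congr (_ *+ _); apply: eq_card => x; rewrite !inE.
rewrite sumrB sumr_const; congr (_ *+ _ - _).
  by apply: eq_card => x; rewrite !inE.
by apply: eq_bigl => x; rewrite inE.
Qed.

(** One more good contributes K, which strictly exceeds any cost that can be subtracted from the
    value of [Q]. *)
Lemma bundle_value_goods_lt i P Q : (#|P| < #|Q|)%N ->
  bundle_value (goods_of_chores I) i P < bundle_value (goods_of_chores I) i Q.
Proof.
move=> ltPQ; rewrite !bundle_value_goods.
have P0 := bundle_value_ge0 I i (inl @^-1: P).
have QK := bundle_value_lt_bigK I i (inl @^-1: Q).
have K0 := le_lt_trans (bundle_value_ge0 I i _) QK.
have : bigK I *+ #|P|.+1 <= bigK I *+ #|Q| by rewrite ler_pMn2l.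
rewrite mulrS; lra.
Qed.

Lemma PMMS_goods_balanced (Y : 'I_n -> {set goods_items n M}) i j :
  allocation Y -> PMMS_goods (goods_of_chores I) Y ->
  (#|Y j| <= #|Y i|.+1)%N.
Proof.
move=> [_ dis] pmms; have [<-//|ij] := eqVneq i j.
rewrite leqNgt; apply/negP=> gt_j.
have cardU : #|Y i :|: Y j| = (#|Y i| + #|Y j|)%N.
  by apply/eqP; rewrite (leq_card_setU _ _).2 dis.
(* With a gap of at least two, the union splits into parts that both have more goods than [Y i], so
   agent [i] prefers each of them to [Y i]. *)
have [|P sP cP] := @exists_subset_card _ (Y i :|: Y j) #|Y i|.+1.
  by rewrite cardU; lia.
have cQ : (#|Y i| < #|(Y i :|: Y j) :\: P|)%N.
  by rewrite cardsDS // cardU cP; lia.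
have /max_min_share_leP/(_ P ((Y i :|: Y j) :\: P)) := pmms i j ij.
rewrite setDE setUIr setUCr setIT (setUidPr sP) -setDE => /(_ erefl).
rewrite disjoint_sym disjoints_subset subsetDr => /(_ isT).
by rewrite leNgt lt_min !bundle_value_goods_lt // cP.
Qed.

(* In a union of two bundles of size m, a bipartition of the chores extends to
   one into two parts of size m by distributing the further goods. *)
Lemma bipartition_extend S (A B : {set M}) :
  A :|: B = inl @^-1: S -> [disjoint A & B] -> #|S| = (2 * #|M|)%N ->
  exists P Q, [/\ P :|: Q = S, [disjoint P & Q],
    inl @^-1: P = A, inl @^-1: Q = B & #|P| = #|M| /\ #|Q| = #|M|].
Proof.
move=> AB dAB cS.
have cAB : #|inl @^-1: S| = (#|A| + #|B|)%N.
  by rewrite -AB; apply/eqP; rewrite (leq_card_setU _ _).2.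
have leA : (#|A| <= #|M|)%N by apply: max_card.
have leB : (#|B| <= #|M|)%N by apply: max_card.
(* [F] pads [A] to [#|M|] goods. Enough further goods lie in [S], because [B] takes up at most
   [#|M|] of its elements. *)
have [|F sF cF] := @exists_subset_card _ (inr @^-1: S) (#|M| - #|A|).
  suff -> : #|inr @^-1: S| = (2 * #|M| - (#|A| + #|B|))%N by lia.
  by rewrite -cS card_sum_preim cAB addKn.
pose P : {set goods_items n M} :=
  [set x | match x with inl g => g \in A | inr t => t \in F end].
have PA : inl @^-1: P = A by apply/setP=> g; rewrite !inE.
have PF : inr @^-1: P = F by apply/setP=> t; rewrite !inE.
have sP : P \subset S.
  apply/subsetP=> -[g|t]; rewrite inE => xP.
    have : g \in A :|: B by rewrite inE xP.
    by rewrite AB inE.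
  by have := subsetP sF t xP; rewrite inE.
have cP : #|P| = #|M| by rewrite card_sum_preim PA PF cF subnKC.
exists P, (S :\: P); split=> //.
- by rewrite setDE setUIr setUCr setIT (setUidPr sP).
- by rewrite disjoint_sym disjoints_subset subsetDr.
- apply/setP=> g; rewrite !inE.
  have /setP/(_ g) := AB; rewrite !inE => <-.
  by have := disjointFr dAB (x := g); case: (g \in A) => [->|] //.
- by split=> //; rewrite cardsDS // cS cP; lia.
Qed.

(** Between bundles of size [#|M|] the multiples of K cancel, so comparing values is comparing costs
    in reverse: a minimum bounded above turns into a maximum bounded below. *)
Lemma PMMS_reduction (Y : 'I_n -> {set goods_items n M}) :
  allocation Y -> (forall i, #|Y i| = #|M|) ->
  PMMS_goods (goods_of_chores I) Y <-> PMMS_chores I (fun i => inl @^-1: Y i).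
Proof.
move=> [_ dis] cY.
have cU i j : i != j -> #|Y i :|: Y j| = (2 * #|M|)%N.
  move=> ij; have /eqP -> : #|Y i :|: Y j| == (#|Y i| + #|Y j|)%N.
    by rewrite (leq_card_setU _ _).2 dis.
  by rewrite !cY mul2n addnn.
have le_size_m i P : #|P| = #|M| ->
    (bundle_value (goods_of_chores I) i P <=
       bundle_value (goods_of_chores I) i (Y i)) =
    (bundle_value I i (inl @^-1: Y i) <= bundle_value I i (inl @^-1: P)).
  by move=> cP; rewrite !bundle_value_goods cP cY lerD2l lerN2.
split=> pmms i j ij.
- apply/le_min_max_shareP => A B AB dAB; rewrite -preimsetU in AB.
  have [P [Q [PQ dPQ <- <- [cP cQ]]]] := bipartition_extend AB dAB (cU i j ij).
  have /max_min_share_leP/(_ P Q PQ dPQ) := pmms i j ij.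
  by rewrite ge_min le_max !le_size_m.
- apply/max_min_share_leP => P Q PQ dPQ; rewrite ge_min.
  have cPQ : (#|P| + #|Q|)%N = (2 * #|M|)%N.
    rewrite -(cU i j ij) -PQ; apply/esym/eqP.
    by rewrite (leq_card_setU _ _).2.
  (* In an unequal split the smaller part is already worth less than [Y i], so the chores condition
     is needed only for equal sizes. *)
  have [ltP|gtP|cP] := ltngtP #|P| #|M|.
  + by rewrite ltW // bundle_value_goods_lt // cY.
  + by rewrite orbC ltW // bundle_value_goods_lt // cY; lia.
  + have cQ : #|Q| = #|M| by lia.
    rewrite !le_size_m // -le_max.
    have /le_min_max_shareP := pmms i j ij; apply.
      by rewrite -!preimsetU PQ.
    rewrite -setI_eq0 -preimsetI.
    by move: dPQ; rewrite -setI_eq0 => /eqP ->; rewrite preimset0.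
Qed.

Lemma allocation_chores (Y : 'I_n -> {set goods_items n M}) :
  allocation Y -> allocation (fun i => inl @^-1: Y i : {set M}).
Proof.
move=> [cov dis]; split=> [|i j ij].
  apply/setP=> g; rewrite inE; apply/bigcupP.
  have : inl g \in \bigcup_(i < n) Y i by rewrite cov inE.
  by case/bigcupP=> i _ gi; exists i; rewrite ?inE.
rewrite -setI_eq0 -preimsetI.
by have := dis i j ij; rewrite -setI_eq0 => /eqP ->; rewrite preimset0.
Qed.

(** Agent [i] lacks [#|M| - #|X i|] goods; summed over the agents, this is exactly the number
    [(n - 1) * #|M|] of further goods. *)
Lemma allocation_fill (X : 'I_n -> {set M}) : (0 < n)%N -> allocation X ->
  exists Y : 'I_n -> {set goods_items n M},
    [/\ allocation Y, forall i, #|Y i| = #|M| & forall i, inl @^-1: Y i = X i].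
Proof.
move=> n0 alX.
have leX i : (#|X i| <= #|M|)%N by apply: max_card.
have [|f cf] :=
    @exists_fun_card_fibers _ 'I_((n - 1) * #|M|) (fun i => #|M| - #|X i|)%N.
  rewrite sumnB // sum_nat_const (sum_card_allocation alX) !card_ord.
  by rewrite mulnBl mul1n.
have [cov dis] := alX.
pose Y i : {set goods_items n M} :=
  [set x | match x with inl g => g \in X i | inr t => f t == i end].
have YX i : inl @^-1: Y i = X i by apply/setP=> g; rewrite !inE.
exists Y; split=> // [|i]; last first.
  rewrite card_sum_preim YX; suff -> : inr @^-1: Y i = [set t | f t == i].
    by rewrite cf subnKC.
  by apply/setP=> t; rewrite !inE.
split=> [|i j ij].
  apply/setP=> -[g|t]; rewrite inE; apply/bigcupP; last by exists (f t); rewrite ?inE.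
  have : g \in \bigcup_(i < n) X i by rewrite cov inE.
  by case/bigcupP=> i _ gi; exists i; rewrite ?inE.
rewrite disjoint_subset; apply/subsetP=> -[g|t]; rewrite !inE.
  by move/(disjointFr (dis i j ij)) ->.
by move/eqP->.
Qed.

End Reduction.

Theorem lemma1 (R : realFieldType) (n : nat) (hn : (2 <= n)%N) (M : finType)
    (I : instance R n M) :
  (exists X : 'I_n -> {set M}, allocation X /\ PMMS_chores I X) <->
  (exists Y : 'I_n -> {set goods_items n M},
     allocation Y /\ PMMS_goods (goods_of_chores I) Y).
Proof.
have n0 : (0 < n)%N by apply: ltnW.
split=> [[X [alX pmms]] | [Y [alY pmms]]].
- have [Y [alY cY YX]] := allocation_fill n0 alX.
  exists Y; split=> //; apply/(PMMS_reduction I alY cY) => i j ij.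
  by rewrite !YX; apply: pmms.
- exists (fun i => inl @^-1: Y i); split; first exact: allocation_chores.
  have cY : forall i, #|Y i| = #|M|.
    apply: constant_of_balanced => [i j|]; first exact: PMMS_goods_balanced alY pmms.
    by rewrite (sum_card_allocation alY) card_goods_items.
  exact/(PMMS_reduction I alY cY).
Qed.
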